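(* There is a problem $f$ such that $\mathrm{FOP}(\mathrm{Det}(f))<_W\mathrm{Det}(\mathrm{FOP}(f))$.
   Context: $\le_W$: Weihrauch reducibility; $f<_W g$ means $f\le_W g$ and $g\not\le_W f$. $\mathrm{FOP}(f)$ (first-order part) is the $\le_W$-maximum of the problems with codomain $\mathbb{N}$ that are Weihrauch reducible to $f$. $\mathrm{Det}(f)$ (deterministic part) is the $\le_W$-maximum of the single-valued problems with codomain $\mathbb{N}^\mathbb{N}$ that are Weihrauch reducible to $f$. Both exist for every problem $f$. *)

(* Defs.v *)
From mathcomp Require Import all_boot classical_sets.
From Stdlib Require Cantor.

Set Implicit Arguments.
Unset Strict Implicit.
Unset Printing Implicit Defensive.

Local Open Scope classical_set_scope.

Definition baire := nat -> nat.

(* Kleene's partial recursive functions relative to an oracle, as codes for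
   unary functions; several arguments are packed with the Cantor pairing. *)
Definition npair (a b : nat) : nat := Cantor.to_nat (a, b).

Inductive code : Type :=
  | Zero | Succ | Fst | Snd | Id
  | Oracle
  | Pair of code & code
  | Comp of code & code
  | Prec of code & code
  | Mu of code.

(* [eval p c v m]: the computation of [c] with oracle [p] on input [v] halts
   with output [m]. [Prec a b] sends <v, n> to [u n], where [u 0] is the value
   of [a] at v and [u i.+1] that of [b] at <v, <i, u i>>. *)
Fixpoint eval (p : baire) (c : code) (v m : nat) {struct c} : Prop :=
  match c with
  | Zero => m = 0
  | Succ => m = v.+1
  | Fst => m = (Cantor.of_nat v).1
  | Snd => m = (Cantor.of_nat v).2
  | Id => m = v
  | Oracle => m = p v
  | Pair a b => exists k l, [/\ eval p a v k, eval p b v l & m = npair k l]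
  | Comp a b => exists2 k, eval p b v k & eval p a k m
  | Prec a b =>
      let: (w, n) := Cantor.of_nat v in
      exists u : nat -> nat,
        [/\ eval p a w (u 0),
            forall i, i < n -> eval p b (npair w (npair i (u i))) (u i.+1)
          & m = u n]
  | Mu a =>
      eval p a (npair v m) 0 /\
      forall i, i < m -> exists k, eval p a (npair v i) k.+1
  end.

(* Partial functions on Baire space are [option]-valued. As usual in
   computable analysis, nothing is required outside the domain of [F]. *)
Definition computable (F : baire -> option baire) : Prop :=
  exists c : code, forall p q, F p = Some q -> forall n, eval p c n (q n).

Definition bpair (p q : baire) : baire :=
  fun n => if odd n then q n./2 else p n./2.

Record repSpace : Type := RepSpace {
  carrier :> Type;
  rep : baire -> option carrier;
  rep_surj : forall x, exists p, rep p = Some x }.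

Lemma rep_baire_surj (x : baire) : exists p : baire, Some p = Some x.
Proof. by exists x. Qed.

Definition Baire : repSpace := RepSpace rep_baire_surj.

Lemma rep_nat_surj (x : nat) : exists p : baire, Some (p 0) = Some x.
Proof. by exists (fun=> x). Qed.

Definition Nat : repSpace := RepSpace rep_nat_surj.

(* A problem is a partial multi-valued function between represented spaces;
   its domain is the set of [x] with [f x] nonempty. *)
Definition problem (X Y : repSpace) : Type := X -> set Y.

Definition single_valued (X Y : repSpace) (f : problem X Y) : Prop :=
  forall x y z, f x y -> f x z -> y = z.

Definition realizer (X Y : repSpace) (f : problem X Y)
    (F : baire -> option baire) : Prop :=
  forall p x, rep X p = Some x -> f x !=set0 ->
    exists q y, [/\ F p = Some q, rep Y q = Some y & f x y].

(* Psi o <id, G o Phi> realizes [f] whenever [G] realizes [g]. *)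
Definition weihrauch_le (X Y Z W : repSpace)
    (f : problem X Y) (g : problem Z W) : Prop :=
  exists Phi Psi : baire -> option baire,
    [/\ computable Phi, computable Psi &
        forall G, realizer g G ->
          realizer f (fun p =>
            obind (fun q => Psi (bpair p q)) (obind G (Phi p)))].

Definition weihrauch_lt (X Y Z W : repSpace)
    (f : problem X Y) (g : problem Z W) : Prop :=
  weihrauch_le f g /\ ~ weihrauch_le g f.

(* FOP(f) and Det(f) are only determined up to Weihrauch equivalence, so they
   are given as relations: "[g] is (a representative of) FOP(f)". *)
Definition is_FOP (X Y Z : repSpace)
    (f : problem X Y) (g : problem Z Nat) : Prop :=
  weihrauch_le g f /\
  forall (V : repSpace) (h : problem V Nat),
    weihrauch_le h f -> weihrauch_le h g.

Definition is_Det (X Y Z : repSpace)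
    (f : problem X Y) (g : problem Z Baire) : Prop :=
  [/\ single_valued g, weihrauch_le g f &
      forall (V : repSpace) (h : problem V Baire),
        single_valued h -> weihrauch_le h f -> weihrauch_le h g].

(* Main.v *)
(* Fix eps : nat -> {0, 1} and let f (below: guess) send a sequence p to
   eps n if n is the position of the first nonzero entry of p, and to either
   of 0 and 1 if p = 0. As f has values in N, FOP(f) = f. Its deterministic part
   is g (filtered), which sends p to p or to 0 according to the answer of f: at
   p = 0 both answers of f lead a single-valued problem to the same result, so
   one runs both computations until they agree or p is seen to be nonzero, in
   which case g(p) reveals the answer of f.
   FOP(g) is the restriction k (lookup) of f to p <> 0: a computation of a number
   from g(p) either halts while p still looks like 0, or p is seen to be nonzero.
   If g were reducible to k, then at p = 0 the reduction would ask for one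
   number eps m; by continuity it asks for the same one at all p = 0^n 1^w with n
   large, so that eps n would be computed there from a constant, which is
   avoided by choosing eps diagonally. *)
Require Import Defs.
From mathcomp Require Import all_boot boolp classical_sets.
From Stdlib Require Cantor.

Set Implicit Arguments.
Unset Strict Implicit.
Unset Printing Implicit Defensive.

Local Open Scope classical_set_scope.

Local Notation pfst v := (Cantor.of_nat v).1.
Local Notation psnd v := (Cantor.of_nat v).2.

(** * Step-bounded evaluation of codes *)

Lemma npairK a b : Cantor.of_nat (npair a b) = (a, b).
Proof. exact: Cantor.cancel_of_to. Qed.

(** On shifted values: [0] if all values below [s] are defined and positive, [1] if an undefined one
    comes before any zero, [m.+2] if the least zero is at [m]. The predecessor merges both failures
    into [0]. *)
Definition search (h : nat -> nat) (s : nat) : nat :=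
  iteri s (fun j r => if r is 0 then
    if h j is t.+1 then (if t is 0 then j.+2 else 0) else 1 else r) 0.

(* Results are shifted: [0] means that [s] steps do not suffice. Oracle queries
   at positions [>= s] also fail, so that only the first [s] values matter. *)
Fixpoint ev (p : baire) (s : nat) (c : code) (v : nat) : nat :=
  match c with
  | Zero => 1
  | Succ => v.+2
  | Fst => (pfst v).+1
  | Snd => (psnd v).+1
  | Id => v.+1
  | Oracle => if v < s then (p v).+1 else 0
  | Pair a b =>
      if ev p s a v is k.+1 then
        if ev p s b v is l.+1 then (npair k l).+1 else 0
      else 0
  | Comp a b => if ev p s b v is k.+1 then ev p s a k else 0
  | Prec a b =>
      iteri (psnd v) (fun i r =>
        if r is u.+1 then ev p s b (npair (pfst v) (npair i u)) else 0)
        (ev p s a (pfst v))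
  | Mu a => (search (fun j => ev p s a (npair v j)) s).-1
  end.

Lemma searchP h s :
  match search h s with
  | 0 => forall j, j < s -> 1 < h j
  | 1 => True
  | m.+2 => h m = 1 /\ forall j, j < m -> 1 < h j
  end.
Proof.
elim: s => [|s] //=; rewrite /search /= -/(search h s).
case: (search h s) => [|[|m]] // IH.
case E: (h s) => [|[|t]] //.
by move=> j; rewrite ltnS leq_eqVlt => /orP[/eqP->|/IH //]; rewrite E.
Qed.

Lemma search0 h s : (forall j, j < s -> 1 < h j) -> search h s = 0.
Proof.
elim: s => // s IH hs; rewrite /search /= -/(search h s) IH => [|j js].
  by have := hs s (leqnn _); case: (h s) => [|[]].
by apply: hs; rewrite ltnW.
Qed.

Lemma search_found h s m :
  h m = 1 -> (forall j, j < m -> 1 < h j) -> m < s -> search h s = m.+2.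
Proof.
move=> hm hlt; elim: s => // s IH.
rewrite ltnS leq_eqVlt /search /= -/(search h s).
by case/orP => [/eqP <-|/IH -> //]; rewrite search0 // hm.
Qed.

(** A halting run has read the oracle only below [s], so it transfers to any oracle with the same
    prefix. This is the form of continuity used later. *)
Lemma ev_sound p q s c v m :
  (forall j, j < s -> q j = p j) -> ev p s c v = m.+1 -> eval q c v m.
Proof.
move=> qp; elim: c v m => [|||||| a IHa b IHb| a IHa b IHb| a IHa b IHb| a IHa] v m /=.
- by case.
- by case.
- by case.
- by case.
- by case.
- by case: ifP => // vs [<-]; rewrite qp.
- case Ea: (ev p s a v) => [//|k]; case Eb: (ev p s b v) => [//|l] [<-].
  by exists k, l; split; [apply: IHa|apply: IHb|].
- case Eb: (ev p s b v) => [//|k] Ea.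
  by exists k; [apply: IHb|apply: IHa].
- case: (Cantor.of_nat v) => w n /=.
  pose S i r := if r is u.+1 then ev p s b (npair w (npair i u)) else 0.
  pose G i := iteri i S (ev p s a w); rewrite -/(G n) => En.
  (* A failure at any round of the iteration persists to the end, so success at the end makes every
     round succeed. *)
  have Gpos i : i <= n -> G i = (G i).-1.+1.
    move=> i_n; move: En; rewrite -(subnKC i_n); case Gi: (G i) => [|//].
    suff -> : G (i + (n - i)) = 0 by [].
    by elim: (n - i) => [|k]; rewrite ?addn0 // addnS /G /= => ->.
  exists (fun i => (G i).-1); split; last by rewrite En.
    by apply: IHa; rewrite -Gpos.
  move=> i i_n; apply: IHb; rewrite -Gpos //= -/(G i) {1}/G /= -/(G i).
  by rewrite (Gpos _ (ltnW i_n)).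
- have := searchP (fun j => ev p s a (npair v j)) s.
  case: search => [|[|m']] //= [h0 hlt] [<-]; split; first exact: IHa.
  move=> i /hlt; case E: ev => [|[|k]] // _; exists k; exact: IHa.
Qed.

(** All late stages rather than some stage, so that finitely many subcomputations share one. *)
Definition eventually (Q : nat -> Prop) := exists s0, forall s, s0 <= s -> Q s.

Lemma eventually_and (Q1 Q2 : nat -> Prop) :
  eventually Q1 -> eventually Q2 -> eventually (fun s => Q1 s /\ Q2 s).
Proof.
move=> [s1 H1] [s2 H2]; exists (maxn s1 s2) => s.
by rewrite geq_max => /andP[/H1 ? /H2 ?].
Qed.

Lemma eventually_lt n (Q : nat -> nat -> Prop) :
  (forall j, j < n -> eventually (Q j)) ->
  eventually (fun s => forall j, j < n -> Q j s).
Proof.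
elim: n => [|n IH] H; first by exists 0.
have [|s0 H0] := eventually_and (IH _) (H n (leqnn _)).
  by move=> j jn; apply: H; rewrite ltnW.
exists s0 => s /H0[Hlt Hn] j; rewrite ltnS leq_eqVlt.
by case/orP => [/eqP->|/Hlt].
Qed.

Lemma ev_complete p c v m :
  eval p c v m -> eventually (fun s => ev p s c v = m.+1).
Proof.
elim: c v m => [|||||| a IHa b IHb| a IHa b IHb| a IHa b IHb| a IHa] v m /=.
- by move->; exists 0.
- by move->; exists 0.
- by move->; exists 0.
- by move->; exists 0.
- by move->; exists 0.
- by move->; exists v.+1 => s ->.
- case=> k [l [/IHa Ha /IHb Hb ->]]; have [s0 H] := eventually_and Ha Hb.
  by exists s0 => s /H[-> ->].
- case=> k /IHb Hb /IHa Ha; have [s0 H] := eventually_and Ha Hb.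
  by exists s0 => s /H[Ea ->].
- case: (Cantor.of_nat v) => w n /= [u [/IHa Ha Hb ->]].
  have {}Hb := eventually_lt (fun i i_n => IHb _ _ (Hb i i_n)).
  have [s0 H] := eventually_and Ha Hb; exists s0 => s /H[Ea Eb].
  by elim: n Eb {Hb H} => //= n IH Eb; rewrite IH ?Eb // => i i_n; apply/Eb/ltnW.
- case=> /IHa H0 Hlt.
  have Hlt' j : j < m -> eventually (fun s => 1 < ev p s a (npair v j)).
    by case/Hlt => k /IHa[s0 H]; exists s0 => s /H ->.
  have [s0 H] := eventually_and H0 (eventually_lt Hlt').
  exists (maxn s0 m.+1) => s; rewrite geq_max => /andP[/H[E0 Elt] ms].
  by rewrite (@search_found _ s m).
Qed.

(** Both computations are run by the evaluator at a common stage, where it has one value. *)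
Lemma eval_fun p c v m m' : eval p c v m -> eval p c v m' -> m = m'.
Proof.
move=> /ev_complete H /ev_complete /(eventually_and H)[s H'].
by have [-> []] := H' s (leqnn _).
Qed.

(** * Functions computable uniformly over a family of oracles *)

Fixpoint subst (d c : code) : code :=
  match c with
  | Oracle => d
  | Pair a b => Pair (subst d a) (subst d b)
  | Comp a b => Comp (subst d a) (subst d b)
  | Prec a b => Prec (subst d a) (subst d b)
  | Mu a => Mu (subst d a)
  | _ => c
  end.

Lemma eval_subst p q d c v m :
  (forall n, eval p d n (q n)) -> eval q c v m -> eval p (subst d c) v m.
Proof.
move=> dq; elim: c v m => [|||||| a IHa b IHb| a IHa b IHb| a IHa b IHb| a IHa] v m //=.
- by move->.
- by case=> k [l [/IHa ? /IHb ? ->]]; exists k, l.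
- by case=> k /IHb ? /IHa ?; exists k.
- case: (Cantor.of_nat v) => w n [u [/IHa Ha Hb ->]].
  by exists u; split=> // i /Hb /IHb.
- by case=> /IHa H0 H; split=> // i /H[k /IHa ?]; exists k.
Qed.

(* [o i] is the oracle available for the instance [i]; the code must not depend
   on [i]. *)
Definition recursive (I : Type) (o : I -> baire) (F : I -> nat -> nat) : Prop :=
  exists c, forall i v, eval (o i) c v (F i v).

Section Recursive.
Variables (I : Type) (o : I -> baire).
Implicit Types A B F : I -> nat -> nat.

Lemma rec_ext F A : (forall i v, F i v = A i v) -> recursive o F -> recursive o A.
Proof. by move=> FA [c H]; exists c => i v; rewrite -FA. Qed.

Lemma rec_id : recursive o (fun _ v => v).
Proof. by exists Id. Qed.

Lemma rec_oracle : recursive o o.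
Proof. by exists Oracle. Qed.

Lemma rec_app F A :
  recursive o F -> recursive o A -> recursive o (fun i v => F i (A i v)).
Proof. by move=> [c H] [d H']; exists (Comp c d) => i v; exists (A i v). Qed.

Lemma rec_succ A : recursive o A -> recursive o (fun i v => (A i v).+1).
Proof. by move=> ?; apply: (@rec_app (fun _ v => v.+1) A) => //; exists Succ. Qed.

Lemma rec_const n : recursive o (fun _ _ => n).
Proof. by elim: n => [|n /rec_succ //]; exists Zero. Qed.

Lemma rec_fst A : recursive o A -> recursive o (fun i v => pfst (A i v)).
Proof. by move=> ?; apply: (@rec_app (fun _ v => pfst v) A) => //; exists Fst. Qed.

Lemma rec_snd A : recursive o A -> recursive o (fun i v => psnd (A i v)).
Proof. by move=> ?; apply: (@rec_app (fun _ v => psnd v) A) => //; exists Snd. Qed.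

Lemma rec_pair A B : recursive o A -> recursive o B ->
  recursive o (fun i v => npair (A i v) (B i v)).
Proof.
move=> [c H] [d H']; exists (Pair c d) => i v.
by exists (A i v), (B i v).
Qed.

Lemma rec_app2 (F : I -> nat -> nat -> nat) A B :
  recursive o (fun i w => F i (pfst w) (psnd w)) ->
  recursive o A -> recursive o B ->
  recursive o (fun i v => F i (A i v) (B i v)).
Proof.
move=> recF recA recB.
by apply: rec_ext (rec_app recF (rec_pair recA recB)) => i v; rewrite npairK.
Qed.

Lemma rec_iteri A N (S : I -> nat -> nat -> nat -> nat) :
  recursive o A -> recursive o N ->
  recursive o (fun i w => S i (pfst w) (pfst (psnd w)) (psnd (psnd w))) ->
  recursive o (fun i v => iteri (N i v) (S i v) (A i v)).
Proof.
move=> [a Ha] recN [b Hb].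
pose F i w := iteri (psnd w) (S i (pfst w)) (A i (pfst w)).
apply: (@rec_ext (fun i v => F i (npair v (N i v)))) => [i v|].
  by rewrite /F npairK.
apply: (@rec_app F) (rec_pair rec_id recN).
rewrite /F; exists (Prec a b) => i w /=; case: (Cantor.of_nat w) => v n /=.
exists (fun m => iteri m (S i v) (A i v)); split=> //= j _.
by have := Hb i (npair v (npair j (iteri j (S i v) (A i v)))); rewrite !npairK.
Qed.

Lemma rec_case A N (B : I -> nat -> nat -> nat) :
  recursive o N -> recursive o A ->
  recursive o (fun i w => B i (pfst w) (psnd w)) ->
  recursive o (fun i v => if N i v is n.+1 then B i v n else A i v).
Proof.
move=> recN recA recB.
(* Each round overwrites the value, so only the last one survives, whose index is the predecessor of
   [N i v]. *)
apply: (@rec_ext (fun i v => iteri (N i v) (fun j _ => B i v j) (A i v))).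
  by move=> i v; case: (N i v).
apply: (rec_iteri (S := fun i v j _ => B i v j)) => //.
apply: rec_app2 recB _ _; first exact/rec_fst/rec_id.
exact/rec_fst/rec_snd/rec_id.
Qed.

Lemma rec_wk F : recursive o F -> recursive o (fun i w => F i (pfst w)).
Proof. by move=> recF; apply: (@rec_app F) => //; exact/rec_fst/rec_id. Qed.

Lemma rec_ifz N A B : recursive o N -> recursive o A -> recursive o B ->
  recursive o (fun i v => if N i v == 0 then A i v else B i v).
Proof.
move=> recN recA recB.
apply: (@rec_ext (fun i v => if N i v is _.+1 then B i v else A i v)).
  by move=> i v; case: (N i v).
by apply: (rec_case (B := fun i v _ => B i v)) => //; apply: rec_wk.
Qed.

Lemma rec_pred A : recursive o A -> recursive o (fun i v => (A i v).-1).
Proof.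
move=> recA; apply: (@rec_ext (fun i v => if A i v is n.+1 then n else 0)).
  by move=> i v; case: (A i v).
apply: (rec_case (B := fun i v n => n)) => //; first exact: rec_const.
exact/rec_snd/rec_id.
Qed.

Lemma rec_sub A B : recursive o A -> recursive o B ->
  recursive o (fun i v => A i v - B i v).
Proof.
move=> recA recB.
apply: (@rec_ext (fun i v => iteri (B i v) (fun _ u => u.-1) (A i v))).
  by move=> i v; elim: (B i v) => [|n /= ->]; rewrite ?subn0 // subnS.
apply: (rec_iteri (S := fun _ _ _ u => u.-1)) => //.
exact/rec_pred/rec_snd/rec_snd/rec_id.
Qed.

Lemma rec_eq A B : recursive o A -> recursive o B ->
  recursive o (fun i v => nat_of_bool (A i v == B i v)).
Proof.
move=> recA recB; apply: (@rec_ext (fun i v =>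
  if A i v - B i v == 0 then if B i v - A i v == 0 then 1 else 0 else 0)).
  by move=> i v; rewrite !subn_eq0 eqn_leq; do 2!case: leqP.
by do 2!(apply: rec_ifz; [exact: rec_sub| |exact: rec_const]); exact: rec_const.
Qed.

Lemma rec_odd A : recursive o A -> recursive o (fun i v => nat_of_bool (odd (A i v))).
Proof.
move=> recA; apply: (@rec_ext (fun i v => iteri (A i v) (fun _ u => 1 - u) 0)).
  by move=> i v; elim: (A i v) => [|n /= ->] //=; case: odd.
apply: (rec_iteri (S := fun _ _ _ u => 1 - u)) => //; first exact: rec_const.
by apply: rec_sub; [exact: rec_const|exact/rec_snd/rec_snd/rec_id].
Qed.

Lemma rec_half A : recursive o A -> recursive o (fun i v => (A i v)./2).
Proof.
move=> recA; apply: (@rec_ext (fun i v =>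
    iteri (A i v) (fun j u => if nat_of_bool (odd j) == 0 then u else u.+1) 0)).
  move=> i v; elim: (A i v) => [|n /= ->] //=; rewrite uphalf_half.
  by case: odd.
apply: (rec_iteri (S := fun _ _ j u =>
  if nat_of_bool (odd j) == 0 then u else u.+1)) => //; first exact: rec_const.
apply: rec_ifz; first exact/rec_odd/rec_fst/rec_snd/rec_id.
  exact/rec_snd/rec_snd/rec_id.
exact/rec_succ/rec_snd/rec_snd/rec_id.
Qed.

Lemma rec_double A : recursive o A -> recursive o (fun i v => (A i v).*2).
Proof.
move=> recA; apply: (@rec_ext (fun i v => iteri (A i v) (fun _ u => u.+2) 0)).
  by move=> i v; elim: (A i v) => [|n /= ->].
apply: (rec_iteri (S := fun _ _ _ u => u.+2)) => //; first exact: rec_const.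
exact/rec_succ/rec_succ/rec_snd/rec_snd/rec_id.
Qed.

Lemma rec_bpair (p q : I -> baire) : recursive o p -> recursive o q ->
  recursive o (fun i => bpair (p i) (q i)).
Proof.
move=> recp recq; apply: (@rec_ext (fun i v =>
  if nat_of_bool (odd v) == 0 then p i v./2 else q i v./2)).
  by move=> i v; rewrite /bpair; case: odd.
apply: rec_ifz; first exact/rec_odd/rec_id.
  by apply: (@rec_app p) => //; exact/rec_half/rec_id.
by apply: (@rec_app q) => //; exact/rec_half/rec_id.
Qed.

(** The search has to end only on the instances in [I]; later [I] is a subtype whose invariant
    guarantees this. *)
Lemma rec_min A : recursive o A -> (forall i v, exists n, A i (npair v n) = 0) ->
  exists2 M, recursive o M & forall i v, A i (npair v (M i v)) = 0.
Proof.
move=> [a Ha] ex; have ex' i v : exists n, A i (npair v n) == 0.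
  by have [n /eqP] := ex i v; exists n.
exists (fun i v => ex_minn (ex' i v)); last by move=> i v; case: ex_minnP => n /eqP.
exists (Mu a) => i v /=; case: ex_minnP => n /eqP An lt; split; first by rewrite -An.
move=> j jn; exists (A i (npair v j)).-1; rewrite prednK // lt0n.
by apply/negP => /lt; rewrite leqNgt jn.
Qed.

(** By recursion on the fixed code [c]. It lets a reduction simulate [c] for a bounded time against
    an oracle of its own making. *)
Lemma rec_ev (p : I -> baire) c :
  recursive o p -> recursive o (fun i w => ev (p i) (psnd w) c (pfst w)).
Proof.
move=> recp; elim: c => [|||||| a IHa b IHb| a IHa b IHb| a IHa b IHb| a IHa] /=.
- exact: rec_const.
- exact/rec_succ/rec_succ/rec_fst/rec_id.
- exact/rec_succ/rec_fst/rec_fst/rec_id.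
- exact/rec_succ/rec_snd/rec_fst/rec_id.
- exact/rec_succ/rec_fst/rec_id.
- apply: (@rec_ext (fun i w =>
    if (pfst w).+1 - psnd w == 0 then (p i (pfst w)).+1 else 0)) => [i w|].
    by rewrite subn_eq0.
  apply: rec_ifz; last exact: rec_const.
    by apply: rec_sub; [exact/rec_succ/rec_fst/rec_id|exact/rec_snd/rec_id].
  exact/rec_succ/rec_wk.
- apply: (rec_case (B := fun i w k =>
    if ev (p i) (psnd w) b (pfst w) is l.+1 then (npair k l).+1 else 0)) => //.
    exact: rec_const.
  apply: (rec_case (B := fun i w l => (npair (psnd w) l).+1)).
  + exact: (@rec_wk (fun i w => ev (p i) (psnd w) b (pfst w))).
  + exact: rec_const.
  + apply/rec_succ/rec_pair; first exact/rec_snd/rec_fst/rec_id.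
    exact/rec_snd/rec_id.
- apply: (rec_case (B := fun i w k => ev (p i) (psnd w) a k)) => //.
    exact: rec_const.
  apply: (rec_app2 (F := fun i v s => ev (p i) s a v)) => //.
    exact/rec_snd/rec_id.
  exact/rec_snd/rec_fst/rec_id.
- apply: (rec_iteri (S := fun i w j r => if r is u.+1 then
    ev (p i) (psnd w) b (npair (pfst (pfst w)) (npair j u)) else 0)).
  + apply: (rec_app2 (F := fun i v s => ev (p i) s a v)) => //.
      exact/rec_fst/rec_fst/rec_id.
    exact/rec_snd/rec_id.
  + exact/rec_snd/rec_fst/rec_id.
  + apply: (rec_case (N := fun i w => psnd (psnd w)) (B := fun i w u =>
      ev (p i) (psnd (pfst w)) b
        (npair (pfst (pfst (pfst w))) (npair (pfst (psnd w)) u)))).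
    * exact/rec_snd/rec_snd/rec_id.
    * exact: rec_const.
    * apply: (rec_app2 (F := fun i v s => ev (p i) s b v)) => //.
        2: exact/rec_snd/rec_fst/rec_fst/rec_id.
      apply: rec_pair; first exact/rec_fst/rec_fst/rec_fst/rec_fst/rec_id.
      by apply: rec_pair; [exact/rec_fst/rec_snd/rec_fst/rec_id|exact/rec_snd/rec_id].
- apply: rec_pred; rewrite /search.
  apply: (rec_iteri (S := fun i w j r => if r is 0 then
    if ev (p i) (psnd w) a (npair (pfst w) j) is t.+1 then
      (if t is 0 then j.+2 else 0) else 1 else r)).
  + exact: rec_const.
  + exact/rec_snd/rec_id.
  + pose w0 (x : nat) := pfst x; pose j0 (x : nat) := pfst (psnd x).
    apply: (@rec_ext (fun i x => if psnd (psnd x) == 0 then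
        if ev (p i) (psnd (w0 x)) a (npair (pfst (w0 x)) (j0 x)) == 0 then 1 else
        if (ev (p i) (psnd (w0 x)) a (npair (pfst (w0 x)) (j0 x))).-1 == 0
        then (j0 x).+2 else 0 else psnd (psnd x))) => [i x|].
      rewrite /w0 /j0; case: (psnd (psnd x)) => //=.
      by case: ev => [|[]].
    have recE : recursive o (fun i x =>
        ev (p i) (psnd (w0 x)) a (npair (pfst (w0 x)) (j0 x))).
      apply: (rec_app2 (F := fun i v s => ev (p i) s a v)) => //.
        2: exact/rec_snd/rec_fst/rec_id.
      apply: rec_pair; first exact/rec_fst/rec_fst/rec_id.
      exact/rec_fst/rec_snd/rec_id.
    apply: rec_ifz; [exact/rec_snd/rec_snd/rec_id| |exact/rec_snd/rec_snd/rec_id].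
    apply: rec_ifz => //; first exact: rec_const.
    apply: rec_ifz; first exact: rec_pred.
      exact/rec_succ/rec_succ/rec_fst/rec_snd/rec_id.
    exact: rec_const.
Qed.

End Recursive.

Lemma rec_trans (I : Type) (o p : I -> baire) F :
  recursive p F -> recursive o p -> recursive o F.
Proof.
move=> [c Hc] [d Hd]; exists (subst d c) => i v.
by apply: (@eval_subst _ (p i)).
Qed.

Lemma rec_bpair_l (I : Type) (p q : I -> baire) :
  recursive (fun i => bpair (p i) (q i)) p.
Proof.
apply: (@rec_ext _ _ (fun i v => bpair (p i) (q i) v.*2)) => [i v|].
  by rewrite /bpair odd_double doubleK.
exact: rec_app (rec_oracle _) (rec_double (rec_id _)).
Qed.

Lemma rec_bpair_r (I : Type) (p q : I -> baire) :
  recursive (fun i => bpair (p i) (q i)) q.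
Proof.
apply: (@rec_ext _ _ (fun i v => bpair (p i) (q i) v.*2.+1)) => [i v|].
  by rewrite /bpair /= odd_double /= uphalf_double.
exact: rec_app (rec_oracle _) (rec_succ (rec_double (rec_id _))).
Qed.

(** * Weihrauch reducibility in terms of codes *)

Definition reduces (X Y Z W : repSpace) (h : problem X Y) (f : problem Z W)
    (c d : code) : Prop :=
  forall p x, rep X p = Some x -> h x !=set0 ->
  exists q z, [/\ forall n, eval p c n (q n), rep Z q = Some z, f z !=set0 &
    forall r w, rep W r = Some w -> f z w ->
    exists t y, [/\ forall n, eval (bpair p r) d n (t n), rep Y t = Some y & h x y]].

Lemma code_functional c : exists2 F : baire -> option baire, computable F &
  forall p q, (forall n, eval p c n (q n)) -> F p = Some q.
Proof.
pose P p q := forall n, eval p c n (q n).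
exists (fun p => if pselect (exists q, P p q) is left e then Some (sval (cid e)) else None).
  by exists c => p q; case: pselect => // e [<-]; case: cid.
move=> p q pq; case: pselect => [e|[]]; last by exists q.
by case: cid => q' pq' /=; congr Some; apply: funext => n; apply: eval_fun (pq n).
Qed.

(** This realizer is undefined off the names of solvable instances, so a reduction that succeeds
    with it has asked a legitimate query. *)
Lemma strict_realizer (Z W : repSpace) (f : problem Z W) :
  exists2 G, realizer f G &
    forall q r, G q = Some r -> exists2 z, rep Z q = Some z & f z !=set0.
Proof.
pose P q r := exists z w, [/\ rep Z q = Some z, rep W r = Some w & f z w].
exists (fun q => if pselect (exists r, P q r) is left e then Some (sval (cid e)) else None).
  move=> q z qz [w fzw]; case: pselect => [e|[]].
    case: cid => r /= [z' [w' [qz' rw' fzw']]]; exists r, w'; split=> //.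
    by move: qz'; rewrite qz => -[->].
  by have [r rw] := rep_surj w; exists r, z, w.
move=> q r; case: pselect => // e _; case: (cid e) => r' [z [w [qz _ fzw]]].
by exists z => //; exists w.
Qed.

Lemma weihrauch_leP (X Y Z W : repSpace) (h : problem X Y) (f : problem Z W) :
  weihrauch_le h f <-> exists c d, reduces h f c d.
Proof.
split=> [[Phi [Psi [[c Hc] [d Hd] H]]]|[c [d H]]].
  exists c, d => p x px hx; have [G rG strictG] := strict_realizer f.
  have [t [y []]] := H _ rG _ _ px hx.
  case Phip: (Phi p) => [q|//] /=; case Gq: (G q) => [r|//] _ _ _.
  have [z qz fz] := strictG _ _ Gq; exists q, z; split=> //; first exact: Hc.
  move=> r' w rw fzw.
  (* Altering the strict realizer at the single query [q] makes it return an arbitrary name of an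
     arbitrary answer. *)
  pose G' q' := if pselect (q' = q) is left _ then Some r' else G q'.
  have rG' : realizer f G'.
    move=> q' z' qz' fz'; rewrite /G'; case: pselect => [eq_q|_]; last exact: rG.
    by exists r', w; split=> //; move: qz'; rewrite eq_q qz => -[<-].
  have [{}t [{}y []]] := H _ rG' _ _ px hx.
  rewrite Phip /= /G'; case: pselect => //= _ /Hd ? ? ?.
  by exists t, y.
have [Phi ? HPhi] := code_functional c; have [Psi ? HPsi] := code_functional d.
exists Phi, Psi; split=> // G rG p x px hx.
have [q [z [/HPhi -> qz fz Hr]]] := H _ _ px hx.
have [r [w [Gq rw fzw]]] := rG _ _ qz fz.
have [t [y [/HPsi Ht ty hxy]]] := Hr _ _ rw fzw.
by exists t, y; rewrite /= Gq.
Qed.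

(** * Countability of codes and the diagonal sequence *)

Fixpoint tree_of_code (c : code) : GenTree.tree nat :=
  match c with
  | Zero => GenTree.Node 0 [::]
  | Succ => GenTree.Node 1 [::]
  | Fst => GenTree.Node 2 [::]
  | Snd => GenTree.Node 3 [::]
  | Id => GenTree.Node 4 [::]
  | Oracle => GenTree.Node 5 [::]
  | Pair a b => GenTree.Node 6 [:: tree_of_code a; tree_of_code b]
  | Comp a b => GenTree.Node 7 [:: tree_of_code a; tree_of_code b]
  | Prec a b => GenTree.Node 8 [:: tree_of_code a; tree_of_code b]
  | Mu a => GenTree.Node 9 [:: tree_of_code a]
  end.

Lemma tree_of_code_inj : injective tree_of_code.
Proof.
elim=> [|||||| a IHa b IHb| a IHa b IHb| a IHa b IHb| a IHa] [] //=.
- by move=> a' b' [/IHa-> /IHb->].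
- by move=> a' b' [/IHa-> /IHb->].
- by move=> a' b' [/IHa-> /IHb->].
- by move=> a' [/IHa->].
Qed.

Lemma code_enumeration : exists dec : nat -> code, forall c, exists e, dec e = c.
Proof.
pose P e c := pickle (tree_of_code c) = e.
exists (fun e => if pselect (exists c, P e c) is left h then sval (cid h) else Zero).
move=> c; exists (pickle (tree_of_code c)).
case: pselect => [h|[]]; last by exists c.
by case: cid => c' /= /(pcan_inj pickleK)/tree_of_code_inj.
Qed.

(** The sequence [0^n 1^w], which tends to the zero sequence as [n] grows. *)
Definition step_at (n : nat) : baire := fun j => n <= j.

(* Padding the encoding makes every pair [(d, b)] defeated by arbitrarily large
   [n]. *)
Lemma diagonal : exists eps : nat -> bool, forall d b n0,
  exists2 n, n0 <= n & ~ eval (bpair (step_at n) (fun=> b)) d n (eps n).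
Proof.
have [dec decP] := code_enumeration.
(* The index [n] is read as [<<e, b>, n0>]: code number, constant and padding. [eps n] is 0 exactly
   when that computation yields 1. *)
exists (fun n => ~~ `[< eval (bpair (step_at n) (fun=> psnd (pfst n)))
                          (dec (pfst (pfst n))) n 1 >]).
move=> d b n0; have [e <-] := decP d; exists (npair (npair e b) n0).
  by apply: leq_trans (leq_addr _ _) _; apply/leP/Cantor.to_nat_non_decreasing.
rewrite !npairK /=; case: asboolP => // H1 H0.
by have := eval_fun H1 H0.
Qed.

(** * First nonzero positions and the three problems *)

Definition first (p : baire) (n : nat) : Prop :=
  p n != 0 /\ forall j, j < n -> p j = 0.

Lemma ex_first p n : p n != 0 -> exists m, first p m.
Proof.
move=> pn; case: (@ex_minnP (fun n => p n != 0)) => [|m pm lt]; first by exists n.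
exists m; split=> // j jm; apply/eqP/negPn/negP => /lt.
by rewrite leqNgt jm.
Qed.

Lemma first_inj p m n : first p m -> first p n -> m = n.
Proof.
move=> [pm ltm] [pn ltn]; case: (ltngtP m n) => // [/ltn|/ltm] H.
  by rewrite H in pm.
by rewrite H in pn.
Qed.

Lemma first_step n : first (step_at n) n.
Proof.
by rewrite /first /step_at leqnn; split=> // j; rewrite ltnNge => /negbTE ->.
Qed.

Definition gate (i : nat) (p : baire) : baire := fun n => if i == 0 then 0 else p n.

Section Witness.
Variable eps : nat -> bool.

Definition guess : problem Baire Nat :=
  fun p i => i <= 1 /\ forall n, first p n -> i = eps n.

Definition filtered : problem Baire Baire :=
  fun p q => exists2 i, guess p i & q = gate i p.

Definition lookup : problem Baire Nat :=
  fun p i => (exists n, p n != 0) /\ guess p i.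

Lemma guess_first p n : first p n -> guess p (eps n).
Proof. by move=> pn; split=> [|m /(first_inj pn) ->]; first case: (eps n). Qed.

Lemma guess_zero p i : (forall n, p n = 0) -> i <= 1 -> guess p i.
Proof. by move=> p0 i1; split=> // n [/eqP]; rewrite p0. Qed.

Lemma zeroVfirst p : (forall n, p n = 0) \/ exists n, first p n.
Proof.
case: (pselect (exists n, p n != 0)) => [[n /ex_first]|H]; first by right.
by left=> n; apply/eqP/negPn/negP => pn; apply: H; exists n.
Qed.

Lemma guess_nonempty p : guess p !=set0.
Proof.
case: (zeroVfirst p) => [/guess_zero H|[n /guess_first H]].
  by exists 0; exact: H.
by exists (nat_of_bool (eps n)).
Qed.

Lemma guess_fun p n i i' : p n != 0 -> guess p i -> guess p i' -> i = i'.
Proof. by move=> /ex_first[m pm] [_ /(_ _ pm)->] [_ /(_ _ pm)->]. Qed.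

Lemma filtered_single : single_valued filtered.
Proof.
move=> p _ _ [i pi ->] [i' pi' ->]; apply: funext => n; rewrite /gate.
case: (eqVneq (p n) 0) => [->|pn]; first by rewrite !if_same.
by rewrite (guess_fun pn pi pi').
Qed.

Lemma rec_gate (I : Type) (o : I -> baire) (r p : I -> baire) :
  recursive o r -> recursive o p -> recursive o (fun i => gate (r i 0) (p i)).
Proof.
move=> recr recp; apply: rec_ifz => //; last exact: rec_const.
by apply: (@rec_app _ _ r) => //; exact: rec_const.
Qed.

(** * Reductions among the three problems *)

Lemma filtered_le_guess : weihrauch_le filtered guess.
Proof.
pose o (i : baire * baire) := bpair i.1 i.2.
have [e He] : recursive o (fun i => gate (i.2 0) i.1).
  exact: rec_gate (rec_bpair_r _ _) (rec_bpair_l _ _).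
apply/weihrauch_leP; exists Oracle, e => p _ [<-] _.
exists p, p; split=> //; first exact: guess_nonempty.
move=> r i [<-] pr; exists (gate (r 0) p), (gate (r 0) p); split=> //.
  exact: (He (p, r)).
by exists (r 0).
Qed.

Lemma guess_le : weihrauch_le guess guess.
Proof.
have [e He] := rec_bpair_r (fun i : baire * baire => i.1) snd.
apply/weihrauch_leP; exists Oracle, e => p _ [<-] p0; exists p, p; split=> //.
by move=> r i [<-] pr; exists r, (r 0); split=> //; exact: (He (p, r)).
Qed.

(** Since [p] is nonzero, a search finds a nonzero entry; the gated sequence vanishes there exactly
    when the answer is 0. *)
Lemma lookup_le_filtered : weihrauch_le lookup filtered.
Proof.
pose I := {xi : baire * nat | (exists n, xi.1 n != 0) /\ guess xi.1 xi.2}.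
pose x (j : I) : baire := (sval j).1; pose q j := gate (sval j).2 (x j).
have recx := rec_bpair_l x q; have recq := rec_bpair_r x q.
have [||M recM MP] := @rec_min I (fun j => bpair (x j) (q j))
  (fun j u => if x j (psnd u) == 0 then 1 else 0).
- apply: rec_ifz; [|exact: rec_const|exact: rec_const].
  by apply: (@rec_app _ _ x) => //; exact/rec_snd/rec_id.
- by move=> j v; have [n xn] := (svalP j).1; exists n; rewrite npairK ifN.
have [e He] : recursive (fun j => bpair (x j) (q j)) (fun j _ => (sval j).2).
  apply: (@rec_ext _ _ (fun j v => if q j (M j v) == 0 then 0 else 1)) => [j v|].
    have := MP j v; rewrite npairK /=; case: eqP => // xM _.
    have [_ [i1 _]] := svalP j; rewrite /q /gate.
    by case: (sval j).2 i1 => [|[|//]] //= _; case: eqP xM.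
  apply: rec_ifz; [|exact: rec_const|exact: rec_const].
  exact: (@rec_app _ _ q).
apply/weihrauch_leP; exists Oracle, e => p _ [<-] [i [p0 pi]].
exists p, p; split=> //; first by exists (gate i p), i.
move=> _ _ [<-] [i' pi' ->]; exists (fun=> i'), i'; split=> //.
exact: (He (exist _ (p, i') (conj p0 pi'))).
Qed.

Lemma filtered_maximal (V : repSpace) (h : problem V Baire) :
  single_valued h -> weihrauch_le h guess -> weihrauch_le h filtered.
Proof.
move=> h_single /weihrauch_leP[c [d H]].
(* Here [z] names an instance of [h], [x] is its query and [i] an answer. Single-valuedness of [h]
   will provide one [t] that serves all answers. *)
pose P (a : baire * baire * nat) := let: (z, x, i) := a in
  [/\ forall n, eval z c n (x n), guess x i &
  exists t : baire, forall i', guess x i' ->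
    forall n, eval (bpair z (fun=> i')) d n (t n)].
pose I := {a | P a}.
pose z (j : I) : baire := (sval j).1.1; pose x (j : I) : baire := (sval j).1.2.
pose q j := gate (sval j).2 (x j).
pose o j := bpair (z j) (q j).
have recz : recursive o z := rec_bpair_l z q.
have recq : recursive o q := rec_bpair_r z q.
have recx : recursive o x.
  by apply: rec_trans recz; exists c => -[[[z' x'] i] []].
pose E b (j : I) n t := ev (bpair (z j) (fun=> b)) t d n.
have recE b (N T : I -> nat -> nat) : recursive o N -> recursive o T ->
    recursive o (fun j v => E b j (N j v) (T j v)).
  apply: rec_app2; apply: rec_ev; apply: rec_bpair => //; exact: rec_const.
(* A nonzero entry of [q] proves that the answer is 1; a zero entry is provisionally read as answer
   0. *)
pose B j n w := if q j (pfst w) == 0 then E 0 j n (psnd w) else E 1 j n (psnd w).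
have recB (N T : I -> nat -> nat) : recursive o N -> recursive o T ->
    recursive o (fun j v => B j (N j v) (T j v)).
  move=> recN recT; apply: rec_ifz; try by apply: recE => //; exact: rec_snd.
  by apply: (@rec_app _ _ q) => //; exact: rec_fst.
(* [w] codes a pair (position, time).
   Either the input is seen to be nonzero, so that [q] reveals the right answer,
   or both answers lead to the same value. *)
pose T j n w := if B j n w == 0 then 1 else if x j (pfst w) == 0 then
  if nat_of_bool (E 0 j n (psnd w) == E 1 j n (psnd w)) == 0 then 1 else 0 else 0.
have [||M recM MP] := @rec_min I o (fun j u => T j (pfst u) (psnd u)).
- apply: rec_ifz; last 1 first.
  + apply: rec_ifz; last exact: rec_const.
      apply: (@rec_app _ _ x) => //; exact/rec_fst/rec_snd/rec_id.
    apply: rec_ifz; [|exact: rec_const|exact: rec_const].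
    by apply: rec_eq; apply: recE; do ?apply: rec_snd; do ?apply: rec_fst; exact: rec_id.
  + by apply: recB; [exact/rec_fst/rec_id|exact/rec_snd/rec_id].
  + exact: rec_const.
- move=> j n; rewrite /T /B /E /q /x /z.
  case: j => -[[z' x'] i] [/= zx gi [t Ht]].
  (* The search ends: at a nonzero position of the query [B] follows the right answer, and for a
     zero query both answers are legitimate and both runs reach [t n]. *)
  case: (pselect (exists s, x' s != 0)) => [[s xs]|x0].
    have [s0 /(_ _ (leqnn _)) Es] := ev_complete (Ht _ gi n).
    exists (npair s s0); rewrite !npairK /= (negPf xs) /gate.
    by case: i {Ht} gi Es => [|[|i]] [// _ _] Es /=; rewrite ?(negPf xs) Es.
  have x'0 s : x' s = 0 by apply/eqP/negPn/negP => xs; apply: x0; exists s.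
  have E0 := ev_complete (Ht 0 (@guess_zero x' 0 x'0 isT) n).
  have E1 := ev_complete (Ht 1 (@guess_zero x' 1 x'0 isT) n).
  have [s /(_ _ (leqnn _))[Es0 Es1]] := eventually_and E0 E1.
  exists (npair 0 s); rewrite !npairK /= x'0 /= Es0 Es1 eqxx /=.
  by rewrite if_same.
have [e He] := rec_pred (recB _ _ (rec_id o) recM).
apply/weihrauch_leP; exists c, e => p v pv hv.
have [x0 [x0' [Hx [<- {x0'}] gx Ht]]] := H _ _ pv hv.
exists x0, x0; split=> //; first by case: gx => i ?; exists (gate i x0), i.
move=> _ _ [<-] [i gi ->].
have [t [_ [Hti [<-] ht]]] := Ht (fun=> i) i erefl gi.
have Pj : P (p, x0, i).
  split=> //; exists t => i' gi' n.
  have [t' [_ [Hti' [<-] ht']]] := Ht (fun=> i') i' erefl gi'.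
  by rewrite (h_single _ _ _ ht ht').
exists t, t; split=> // n; have := He (exist _ _ Pj) n.
have := MP (exist _ _ Pj) n; rewrite npairK /T /=; move: (M _ n) => w.
case Bw: (B _ n w) => [//|m] /= Tw; congr (eval _ _ _ _) => /=.
(* At an accepted [w] a wrong provisional reading is harmless: the query is still zero there, and
   both runs agree. *)
suff : E i (exist _ _ Pj) n (psnd w) = B (exist _ _ Pj) n w.
  rewrite Bw => /(ev_sound (fun j _ => erefl _)) Em.
  by apply: eval_fun Em (Hti n).
move: Tw {Bw}; rewrite /B /q /x /gate /=.
case: i gi {Hti ht} Pj => [|[|i]] [// _ _] Pj //=.
by case: eqP => // _; case: (E 0 _ _ _ =P _) => // ->.
Qed.

(* The first nonzero entry of [y z x] is that of [x], unless [d] answers before,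
   and then so early that it cannot tell [gate 0 x] from [gate 1 x]. *)
Lemma lookup_maximal (V : repSpace) (h : problem V Nat) :
  weihrauch_le h filtered -> weihrauch_le h lookup.
Proof.
move=> /weihrauch_leP[c [d H]].
(* A number is read off entry 0 of its name, so [d] is run on input 0 only; the constant 0 is what
   the gated query looks like so far. *)
pose E (z : baire) s := ev (bpair z (fun=> 0)) s d 0.
pose y (z x : baire) : baire := fun s => if x s == 0 then E z s else 1.
pose computes (z x : baire) := forall n, eval z c n (x n).
pose I := {zx : baire * baire | computes zx.1 zx.2}.
have [e He] : recursive (fun j : I => (sval j).1) (fun j => y (sval j).1 (sval j).2).
  have recx : recursive (fun j : I => (sval j).1) (fun j => (sval j).2).
    by exists c => -[[z' x'] ?].
  apply: rec_ifz => //; last exact: rec_const.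
  apply: (rec_app2 (F := fun j v s => ev (bpair (sval j).1 (fun=> 0)) s d v)).
  - apply: rec_ev; apply: rec_bpair; first exact: rec_oracle.
    exact: rec_const.
  - exact: rec_const.
  - exact: rec_id.
pose J := {a : baire * baire * baire | computes a.1.1 a.1.2}.
pose z (j : J) : baire := (sval j).1.1; pose x (j : J) : baire := (sval j).1.2.
pose r (j : J) : baire := (sval j).2.
have [e' He'] : recursive (fun j => bpair (z j) (r j))
    (fun j => bpair (z j) (gate (r j 0) (x j))).
  have recz := rec_bpair_l z r; apply: rec_bpair => //.
  apply: rec_gate; first exact: rec_bpair_r.
  by apply: rec_trans recz; exists c => -[[[z' x'] ?] ?].
(* Composing with [Zero] makes the output a constant name of the number found. *)
apply/weihrauch_leP; exists e, (Comp (subst e' d) Zero) => p v pv hv.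
have [x0 [x0' [Hx [<- {x0'}] [_ [i0 gi0 _]] Ht]]] := H _ _ pv hv.
have Hd i : guess x0 i ->
    exists t, eval (bpair p (gate i x0)) d 0 t /\ h v t.
  move=> gi; have [|t [_ [/(_ 0) Ht0 [<-] ht]]] := Ht (gate i x0) _ erefl.
    by exists i.
  by exists (t 0).
(* Position [j] of the paired oracle reads entry [j./2 <= j] of a component, so a bound on positions
   also bounds the entries read. *)
have gate0 m i : (forall j, j < m -> x0 j = 0) -> forall j, j < m ->
    bpair p (gate i x0) j = bpair p (fun=> 0) j.
  move=> xm j jm; rewrite /bpair /gate; case: ifP => // _; case: ifP => // _.
  by rewrite xm // -divn2 (leq_ltn_trans (leq_div _ _) jm).
exists (y p x0), (y p x0); split=> //.
- exact: (He (exist _ (p, x0) Hx)).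
- have [n yn] : exists n, y p x0 n != 0.
    case: (zeroVfirst x0) => [x00|[n [xn _]]]; last first.
      by exists n; rewrite /y (negPf xn).
    (* For [x0 = 0] the true gated sequence is 0, so the simulated run halts and marks an entry of
       [y]. *)
    have [t [Et _]] := Hd _ gi0.
    have gateE : gate i0 x0 = fun=> 0.
      by apply: funext => k; rewrite /gate x00 if_same.
    rewrite gateE in Et; have [s /(_ _ (leqnn _)) Es] := ev_complete Et.
    by exists s; rewrite /y x00 /E Es.
  have [i gi] := guess_nonempty (y p x0).
  by exists i; split=> //; exists n.
move=> r0 _ [<-] [[n yn] [_ gy]].
suff [t [Et ht]] : exists t, eval (bpair p (gate (r0 0) x0)) d 0 t /\ h v t.
  exists (fun=> t), t; split=> // k; exists 0 => //.
  by apply: eval_subst Et; exact: (He' (exist _ (p, x0, r0) Hx)).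
have [m [ym ltm]] := ex_first yn; rewrite (gy m) //.
have xlt j : j < m -> x0 j = 0.
  by move/ltm; rewrite /y; case: eqP.
case: (eqVneq (x0 m) 0) => [xm|xm]; last exact/Hd/guess_first.
move: ym; rewrite /y xm eqxx /E; case Em: ev => [//|t] _.
(* Here [eps m] need not be a correct guess for [x0], but the run halts before its oracle can differ
   from that of the correct guess [i0]. *)
have [t' [Et' ht']] := Hd _ gi0; exists t; split.
  by apply: ev_sound Em; exact: gate0.
suff -> : t = t' by [].
by apply: eval_fun Et'; apply: ev_sound Em; exact: gate0.
Qed.

(* At the zero sequence the reduction queries a fixed [eps m]; by continuity it
   queries the same one at all [step_at n] with [n] large. *)
Lemma filtered_not_le_lookup :
  (forall d b n0,
    exists2 n, n0 <= n & ~ eval (bpair (step_at n) (fun=> b)) d n (eps n)) ->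
  ~ weihrauch_le filtered lookup.
Proof.
move=> diag /weihrauch_leP[c [d H]].
have dom p : filtered p !=set0.
  by have [i gi] := guess_nonempty p; exists (gate i p), i.
have [q [q0 [Hq [<- {q0}] [_ [[k /ex_first[m [qm ltm]]] _]] _]]] := H (fun=> 0) _ erefl (dom _).
have [s0 Hs] := eventually_lt (fun j (_ : j < m.+1) => ev_complete (Hq j)).
(* Below [s0] the sequence [step_at n] looks like zero, so its query also has its first nonzero
   entry at [m]; hence [eps m] is the constant to defeat. *)
have [n s0n []] := diag d (eps m) s0.
have [q' [q0 [Hq' [<- {q0}] _ ]]] := H (step_at n) _ erefl (dom _).
have q'q j : j < m.+1 -> q' j = q j.
  move=> jm; apply: eval_fun (Hq' j) _; apply: ev_sound (Hs _ (leqnn _) _ jm).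
  move=> k' ks; rewrite /step_at leqNgt (leq_trans ks) //.
have q'm : first q' m.
  split=> [|j jm]; first by rewrite q'q.
  by rewrite q'q ?ltm // ltnW.
case/(_ (fun=> eps m) _ erefl) => [|t [_ [Ht [<-] [i [_ gi] tE]]]].
  by split; [exists m; case: q'm|exact: guess_first].
(* Entry [n] of [step_at n] is 1, so entry [n] of its gated version is [eps n] itself. *)
have := Ht n; rewrite tE (gi n (first_step n)) /gate /step_at leqnn.
by case: (eps n).
Qed.

End Witness.

Theorem theorem6p6 :
  exists (X Y : repSpace) (f : problem X Y)
         (D : repSpace) (det_f : problem D Baire)
         (FD : repSpace) (fop_det_f : problem FD Nat)
         (P : repSpace) (fop_f : problem P Nat)
         (DP : repSpace) (det_fop_f : problem DP Baire),
    is_Det f det_f /\ is_FOP det_f fop_det_f /\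
    is_FOP f fop_f /\ is_Det fop_f det_fop_f /\
    weihrauch_lt fop_det_f det_fop_f.
Proof.
have [eps diag] := diagonal.
have det : is_Det (guess eps) (filtered eps).
  split; [exact: filtered_single|exact: filtered_le_guess|].
  exact: filtered_maximal.
exists Baire, Nat, (guess eps), Baire, (filtered eps), Baire, (lookup eps).
exists Baire, (guess eps), Baire, (filtered eps); split=> //.
split; first by split; [exact: lookup_le_filtered|exact: lookup_maximal].
split; first by split; [exact: guess_le|].
split=> //; split; first exact: lookup_le_filtered.
exact: filtered_not_le_lookup.
Qed.
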